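(* Let $\kappa\in\mathbb{N}$, $\eta\in\{2,3,\ldots\}\cup\{\infty\}$, $p\in\mathbb{N}$, $p\ge1$, and assume $\pmb{\lambda}=\{\lambda_{-k}\}_{k=0}^{\kappa-1}\cup\{\lambda_{i,j}\}_{i,j=1}^{\eta,p}\subset(0,\infty)$ admits a subnormal completion. Then for every $M\in(0,\infty)$ the set $\mathcal{U}^M_{\pmb{\lambda}}$ is compact in $\mathcal{P}([0,M])^{\eta}$ with the product of the weak topologies.
   Context: $\mathcal{P}([0,M])$ is the set of Borel probability measures on $[0,M]$ with the weak topology (convergence against continuous functions). $\mathcal{U}^M_{\pmb{\lambda}}$ is the set of sequences $(\mu_i)_{i=1}^{\eta}$ of Borel measures on $[0,M]$ such that $\prod_{j=2}^{n+1}\lambda_{i,j}^2=\int_0^M t^n\,d\mu_i$ for $i\in\mathbb{N}\cap[1,\eta]$, $n\in\mathbb{N}\cap[0,p-1]$ (empty product $=1$, so each $\mu_i$ is a probability measure); $\sum_{i=1}^{\eta}\lambda_{i,1}^2\int_0^M t^{-k-1}d\mu_i(t)=\frac{1}{\prod_{j=0}^{k-1}\lambda_{-j}^2}$ for $k\in\mathbb{N}\cap[0,\kappa-1]$; and $\sum_{i=1}^{\eta}\lambda_{i,1}^2\int_0^M t^{-\kappa-1}d\mu_i(t)\le\frac{1}{\prod_{j=0}^{\kappa-1}\lambda_{-j}^2}$ (with $1/0=\infty$). Subnormal completion: there is a bounded subnormal weighted shift on the directed tree $\mathcal{T}_{\eta,\kappa}$ (vertices $\{-k\}_{0\le k\le\kappa}\sqcup\{(i,j)\}$,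 edges $(-k,-k+1)$, $(0,(i,1))$, $((i,j),(i,j+1))$, $S e_v=\sum_{u\text{ child of }v}\lambda'_ue_u$) whose weights at $-k$ ($k\le\kappa-1$) and $(i,j)$ ($j\le p$) equal the given $\lambda$'s. *)

(* Defs.v *)
From HB Require Import structures.
From mathcomp Require Import all_boot all_order all_algebra.
From mathcomp Require Import all_classical all_reals all_analysis.
From mathcomp Require Import complex.
Set Implicit Arguments. Unset Strict Implicit. Unset Printing Implicit Defensive.
Import Order.TTheory GRing.Theory Num.Theory.
Import numFieldNormedType.Exports.
Local Open Scope classical_set_scope.
Local Open Scope ring_scope.

(* Index set of the branches: eta = None encodes eta = infinity,             *)
(* eta = Some n encodes eta = n.  Branch indices are 1-based: 1 <= i <= eta. *)
Definition in_idx (eta : option nat) (i : nat) : bool :=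
  match eta with
  | None => (1 <= i)%N
  | Some n => (1 <= i <= n)%N
  end.

Definition idx (eta : option nat) := {i : nat | in_idx eta i}.

(* The directed tree T_{eta,kappa}.                                          *)
(*   Trunk k  = vertex -k  (0 <= k <= kappa),  root = Trunk kappa            *)
(*   Br i j   = vertex (i,j) (i in [1,eta], j >= 1)                           *)
(* edges: (Trunk k.+1, Trunk k), (Trunk 0, Br i 1), (Br i j, Br i j.+1).     *)
Inductive vtx := Trunk of nat | Br of nat & nat.

Definition is_vtx (eta : option nat) (kappa : nat) (v : vtx) : Prop :=
  match v with
  | Trunk k => (k <= kappa)%N
  | Br i j => in_idx eta i /\ (1 <= j)%N
  end.

(* non-root vertices (those carrying a weight) *)
Definition is_nonroot (eta : option nat) (kappa : nat) (v : vtx) : Prop :=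
  match v with
  | Trunk k => (k < kappa)%N
  | Br i j => in_idx eta i /\ (1 <= j)%N
  end.

Section Hilbert.
Variable C : numClosedFieldType.

(* squared norm *)
Definition nrm2 (V : lmodType C) (ip : V -> V -> C) (x : V) : C := ip x x.

Definition hconverges (V : lmodType C) (ip : V -> V -> C)
    (u : nat -> V) (l : V) : Prop :=
  forall e : C, 0 < e -> exists N : nat, forall n : nat, (N <= n)%N ->
    nrm2 ip (u n - l) < e.

Definition hcauchy (V : lmodType C) (ip : V -> V -> C) (u : nat -> V) : Prop :=
  forall e : C, 0 < e -> exists N : nat, forall m n : nat,
    (N <= m)%N -> (N <= n)%N -> nrm2 ip (u m - u n) < e.

(* (V, ip) is a complex Hilbert space *)
Definition is_hilbert (V : lmodType C) (ip : V -> V -> C) : Prop :=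
  [/\ (forall (a : C) (x y z : V), ip (a *: x + y) z = a * ip x z + ip y z),
      (forall x y : V, ip y x = (ip x y)^*),
      (forall x : V, 0 <= ip x x),
      (forall x : V, ip x x = 0 -> x = 0) &
      (forall u : nat -> V, hcauchy ip u -> exists l : V, hconverges ip u l)].

Definition is_linear_op (V : lmodType C) (N : V -> V) : Prop :=
  forall (a : C) (x y : V), N (a *: x + y) = a *: N x + N y.

Definition is_bounded_op (V : lmodType C) (ip : V -> V -> C) (N : V -> V) : Prop :=
  exists c : C, forall x : V, nrm2 ip (N x) <= c * nrm2 ip x.

(* bounded normal operator: N has an adjoint N* and N* N = N N* *)
Definition is_normal_op (V : lmodType C) (ip : V -> V -> C) (N : V -> V) : Prop :=
  [/\ is_linear_op N, is_bounded_op ip N &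
      exists Ns : V -> V, (forall x y : V, ip (N x) y = ip x (Ns y)) /\
                          (forall x : V, Ns (N x) = N (Ns x))].
End Hilbert.

Section Shift.
Variable R : realType.
Local Notation C := R[i].

(* Boundedness of the weighted shift S_lam on l^2(V):                        *)
(* ||S e_v||^2 = sum_{u child of v} lam_u^2 is uniformly bounded in v.        *)
Definition shift_bounded (eta : option nat) (kappa : nat) (lam : vtx -> R) : Prop :=
  exists c : R,
    (forall n : nat, \sum_(1 <= i < n | in_idx eta i) lam (Br i 1) ^+ 2 <= c) /\
    (forall k : nat, (k < kappa)%N -> lam (Trunk k) ^+ 2 <= c) /\
    (forall i j : nat, in_idx eta i -> (1 <= j)%N -> lam (Br i j.+1) ^+ 2 <= c).

(* S_lam is subnormal: there are a complex Hilbert space K, a bounded normal *)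
(* operator N on K and an isometric embedding J : l^2(V) -> K (given by the  *)
(* orthonormal family x_v = J e_v) with N J = J S_lam, i.e.                   *)
(* N x_v = sum_{u child of v} lam_u x_u  (norm-convergent series in K).       *)
Definition shift_subnormal (eta : option nat) (kappa : nat) (lam : vtx -> R) : Prop :=
  exists (K : lmodType C) (ip : K -> K -> C) (N : K -> K) (x : vtx -> K),
    [/\ is_hilbert ip /\ is_normal_op ip N,
        (* orthonormality of the x_v *)
        (forall u v : vtx, is_vtx eta kappa u -> is_vtx eta kappa v ->
           (u = v -> ip (x u) (x v) = 1) /\ (u <> v -> ip (x u) (x v) = 0)),
        (* N x_{-(k+1)} = lam_{-k} x_{-k} *)
        (forall k : nat, (k < kappa)%N ->
           N (x (Trunk k.+1)) = ((lam (Trunk k))%:C)%C *: x (Trunk k)),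
        (* N x_{(i,j)} = lam_{(i,j+1)} x_{(i,j+1)} *)
        (forall i j : nat, in_idx eta i -> (1 <= j)%N ->
           N (x (Br i j)) = ((lam (Br i j.+1))%:C)%C *: x (Br i j.+1)) &
        (* N x_0 = sum_{i=1}^{eta} lam_{(i,1)} x_{(i,1)} *)
        hconverges ip
          (fun n => \sum_(1 <= i < n | in_idx eta i)
                      ((lam (Br i 1))%:C)%C *: x (Br i 1))
          (N (x (Trunk 0)))].

(* lam_tr k = lambda_{-k} (k <= kappa-1), lam_br i j = lambda_{i,j}           *)
(* (1 <= i <= eta, 1 <= j <= p).  A subnormal completion is a bounded        *)
(* subnormal weighted shift on T_{eta,kappa} with positive weights extending *)
(* the given ones.                                                           *)
Definition has_subnormal_completion (eta : option nat) (kappa p : nat)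
    (lam_tr : nat -> R) (lam_br : nat -> nat -> R) : Prop :=
  exists lam : vtx -> R,
    [/\ (forall v, is_nonroot eta kappa v -> 0 < lam v),
        (forall k : nat, (k < kappa)%N -> lam (Trunk k) = lam_tr k),
        (forall i j : nat, in_idx eta i -> (1 <= j <= p)%N -> lam (Br i j) = lam_br i j),
        shift_bounded eta kappa lam &
        shift_subnormal eta kappa lam].

(* P([0,M]): Borel probability measures on [0,M], represented as Borel      *)
(* probability measures on R giving full mass to [0,M].                      *)
Record PM (M : R) := MkPM {
  pm_mu : probability R R ;
  pm_supp : pm_mu `[0, M]%classic = 1%E }.

HB.instance Definition _ (M : R) := gen_eqMixin (PM M).
HB.instance Definition _ (M : R) := gen_choiceMixin (PM M).

(* real continuous functions on [0,M] *)
Definition CF (M : R) := {f : R -> R | {within `[0, M]%classic, continuous f}}.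

(* mu |-> (f |-> int_[0,M] f dmu) *)
Definition pm_eval (M : R) (mu : PM M) : prod_topology (fun _ : CF M => (R : topologicalType)) :=
  fun f => fine (\int[pm_mu mu]_(t in `[0, M]%classic) (proj1_sig f t)%:E).

(* P([0,M]) with the weak topology (convergence against continuous functions *)
(* on [0,M]): the initial topology induced by pm_eval.                       *)
Definition PMw (M : R) : topologicalType := initial_topology (@pm_eval M).

(* P([0,M])^eta with the product of the weak topologies *)
Definition PMprod (M : R) (eta : option nat) : topologicalType :=
  prod_topology (fun _ : idx eta => PMw M).

Definition measure_of (M : R) (m : PMw M) : probability R R := pm_mu m.

(* t |-> t^{-k-1} on [0,M], with value +oo at t = 0 *)
Definition inv_pow (k : nat) (t : R) : \bar R :=
  if t == 0 then +oo%E else ((t ^-1) ^+ k.+1)%:E.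

(* the set U^M_lambda *)
Definition U_set (M : R) (eta : option nat) (kappa p : nat)
    (lam_tr : nat -> R) (lam_br : nat -> nat -> R) : set (PMprod M eta) :=
  [set mu : PMprod M eta |
     (forall (i : idx eta) (n : nat), (n < p)%N ->
        ((\prod_(2 <= j < n.+2) lam_br (proj1_sig i) j ^+ 2)%R%:E =
         \int[measure_of (mu i)]_(t in `[0%R, M]%classic) (t ^+ n)%R%:E)%E) /\
     (forall k : nat, (k < kappa)%N ->
        (\esum_(i in [set: idx eta])
           ((lam_br (proj1_sig i) 1 ^+ 2)%R%:E *
            \int[measure_of (mu i)]_(t in `[0%R, M]%classic) inv_pow k t)%E
         = ((\prod_(0 <= j < k) lam_tr j ^+ 2)^-1)%:E)) /\
     (\esum_(i in [set: idx eta])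
        ((lam_br (proj1_sig i) 1 ^+ 2)%R%:E *
         \int[measure_of (mu i)]_(t in `[0%R, M]%classic) inv_pow kappa t)%E
      <= ((\prod_(0 <= j < kappa) lam_tr j ^+ 2)^-1)%:E)%E].
End Shift.
Arguments U_set {R} M eta kappa p lam_tr lam_br.

(* Main.v *)
Require Import Defs.
From HB Require Import structures.
From mathcomp Require Import all_boot all_order all_algebra.
From mathcomp Require Import all_classical all_reals all_analysis.
From mathcomp Require Import complex.
From mathcomp Require Import lra measurable_realfun.
Import Order.TTheory GRing.Theory Num.Theory.
Import numFieldNormedType.Exports.
Local Open Scope classical_set_scope.
Local Open Scope ring_scope.

(** P([0,M]) is weakly compact: along an ultrafilter the distribution functions
    converge pointwise, the right-continuous regularization H of the limit is
    the distribution function of some nu in P([0,M]), and convergence holds at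
    every point where H agrees with the limit.  Such points are dense, and every
    continuous function on [0,M] is uniformly close to step functions jumping at
    them.  By Tychonoff it remains to see that U is closed.

    The moment conditions are continuous.  Truncating t^(-k-1) at the level
    t = 1/(N+1) presents S_k(mu) = sum_i lambda_(i,1)^2 int t^(-k-1) dmu_i as a
    supremum of continuous functions, so {S_k <= c} is closed.  For k < kappa
    the pointwise bound t^(-k-1) <= trunc_N + t^(-kappa-1)/(N+1), together with
    the summability of lambda_(i,1)^2 (boundedness of the completion), shows
    that on {S_kappa <= c} the function S_k is a uniform limit of truncated
    finite sums, hence {S_kappa <= c, S_k = d} is closed as well. *)

(** * Limits of distribution functions along ultrafilters *)

(** The image filter has a cluster point by compactness of [[a, b]]. An ultrafilter contains the
    preimage of U or of its complement, so this cluster point is a limit. *)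
Lemma ultra_cvg_itv {T : Type} {R : realType} {F : set_system T}
    (UF : UltraFilter F) {g : T -> R} {a b : R} :
  (forall x, a <= g x <= b) ->
  exists2 l : R, a <= l <= b & g x @[x --> F] --> l.
Proof.
move=> gab.
have PF : ProperFilter F by exact: ultra_proper.
have gFab : (g x @[x --> F]) `[a, b]%classic.
  by rewrite /fmap/=; apply: (@filterS _ F _ setT) => [x _|]; rewrite /= ?in_itv ?gab//; exact: filterT.
have [l [/= lab lF]] := segment_compact (fmap_proper_filter g PF) gFab.
exists l; first by move: lab; rewrite in_itv.
move=> U lU.
have [//|FgU] := in_ultra_setVsetC (g @^-1` U) UF.
have [y [/= nUy Uy]] := lF (~` U) U FgU lU.
by [].
Qed.

(** * Right-continuous regularization of a monotone function *)

Section right_regularization.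
Context {R : realType} (G : R -> R).
Hypothesis ndG : {homo G : x y / x <= y}.
Hypothesis G0 : forall x, 0 <= G x.

(** For nondecreasing [G] this infimum is the right limit G(x+). *)
Definition right_reg (x : R) : R := inf (G @` `]x, +oo[).

Let Gne x : G @` `]x, +oo[ !=set0.
Proof. by exists (G (x + 1)), (x + 1) => //=; rewrite in_itv/= andbT ltrDl. Qed.

Let Glb x : has_lbound (G @` `]x, +oo[).
Proof. by exists 0 => _ [y _ <-]. Qed.

Lemma le_right_reg x : G x <= right_reg x.
Proof.
apply: lb_le_inf => // _ [y + <-] => /=; rewrite in_itv/= andbT => /ltW.
exact: ndG.
Qed.

Lemma right_reg_le x y : x < y -> right_reg x <= G y.
Proof.
by move=> xy; apply: ge_inf => //; exists y => //=; rewrite in_itv/= andbT.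
Qed.

Lemma right_reg_nd : {homo right_reg : x y / x <= y}.
Proof.
move=> x y; rewrite le_eqVlt => /predU1P[->//|xy].
exact: le_trans (right_reg_le _ _ xy) (le_right_reg y).
Qed.

Lemma right_reg_rc : right_continuous right_reg.
Proof.
move=> a.
have ndH : {in Interval (BRight a) (BInfty _ false) &, nondecreasing_fun right_reg}.
  by move=> x y _ _; exact: right_reg_nd.
have lbH : has_lbound (right_reg @` [set` Interval (BRight a) (BInfty _ false)]).
  by exists 0 => _ [y _ <-]; exact: le_trans (le_right_reg y).
have := @nondecreasing_at_right_cvgr R right_reg a (BInfty _ false) isT ndH lbH.
suff -> : inf (right_reg @` [set` Interval (BRight a) (BInfty _ false)]) =
  right_reg a by [].
apply/eqP; rewrite eq_le; apply/andP; split.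
  apply: lb_le_inf => // _ [y + <-] => /=; rewrite in_itv/= andbT => ay.
  (* The midpoint m separates [a] from [y]: [right_reg m <= G y], and m is admissible in the infimum
     over points right of [a]. *)
  have am : a < (a + y) / 2 by rewrite midf_lt.
  have my : (a + y) / 2 < y by rewrite midf_lt.
  apply: le_trans (right_reg_le _ _ my); apply: ge_inf => //.
  by exists ((a + y) / 2) => //=; rewrite in_itv/= andbT.
apply: lb_le_inf.
  by exists (right_reg (a + 1)), (a + 1) => //=; rewrite in_itv/= andbT ltrDl.
move=> _ [y + <-] => /=; rewrite in_itv/= andbT => /ltW; exact: right_reg_nd.
Qed.

(* The open intervals ]G x, right_reg x[ are pairwise disjoint, so only
   countably many of them are nonempty. *)
Lemma right_reg_dense (a b : R) : a < b ->
  exists2 x, a < x < b & right_reg x = G x.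
Proof.
move=> ab; apply: contrapT => noeq.
(* Each x in ]a, b[ gets a rational inside its jump; the value 0 elsewhere only makes the choice
   total. *)
have bad x : exists q : rat, `]a, b[%classic x -> G x < ratr q < right_reg x.
  have [xab|xab] := pselect (`]a, b[%classic x); last by exists 0.
  have : G x < right_reg x.
    rewrite lt_neqAle le_right_reg andbT; apply/eqP => GH.
    by apply: noeq; exists x.
  by move=> /rat_in_itvoo[q]; rewrite in_itv/=; exists q.
have [q qP] := choice bad.
(* If x < y shared the rational q, then q < right_reg x <= G y < q. So q is injective on ]a, b[,
   which would be countable and hence Lebesgue null, although its length b - a is positive. *)
have cab : countable `]a, b[%classic.
  apply/countable_injP; exists (pickle \o q) => x y /[!inE] xab yab /=.
  move=> /(pcan_inj pickleK) qxy.
  have /andP[Gx Hx] := qP _ xab; have /andP[Gy Hy] := qP _ yab.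
  apply/eqP; rewrite eq_le !leNgt; apply/andP; split; apply/negP.
  - move=> /right_reg_le; rewrite leNgt => /negP; apply.
    by rewrite (lt_trans Gx)// qxy.
  - move=> /right_reg_le; rewrite leNgt => /negP; apply.
    by rewrite (lt_trans Gy)// -qxy.
have := countable_lebesgue_measure0 cab.
rewrite lebesgue_measure_itv/= lte_fin ab => /eqP.
by rewrite -EFinB eqe subr_eq0 => /eqP ba; rewrite ba ltxx in ab.
Qed.

End right_regularization.

(** * Helly selection along an ultrafilter *)

Section helly.
Context {R : realType} {M : R}.

(** The Lebesgue-Stieltjes measure lives on [measurableTypeR R]; its image under this identity is a
    probability on the type [R] used by [PM]. *)
Let idTR : measurableTypeR R -> R := idfun.

#[local] HB.instance Definition _ :=
  @isMeasurableFun.Build _ _ _ _ idTR (@measurable_id _ _ setT).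

Lemma cdf_probability (H : R -> R) : {homo H : x y / x <= y} ->
  right_continuous H -> 0 <= M ->
  (forall x : R, x < 0 -> H x = 0) -> (forall x : R, M <= x -> H x = 1) ->
  exists nu : PM M, forall x, pm_mu nu `]-oo, x]%classic = (H x)%:E.
Proof.
move=> ndH rcH M0 H0 H1.
have HNy : H @ -oo --> (0 : R).
  apply: cvg_near_cst; exists 0; split; [exact: num_real|] => x x0.
  exact: H0.
have Hy : H @ +oo --> (1 : R).
  apply: cvg_near_cst; exists M; split; [exact: num_real|].
  by move=> x /ltW Mx; exact: H1.
pose mixin1 := isCumulative.Build R _ R H ndH rcH.
pose mixin2 := isCumulativeBounded.Build R 0 1 H HNy Hy.
pose cH : cumulativeBounded (0 : R) (1 : R) := HB.pack H mixin1 mixin2.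
pose lsH : probability (measurableTypeR R) R := lebesgue_stieltjes_measure cH.
pose nu : probability R R := distribution lsH (idTR : {RV lsH >-> R}).
have nuE x : nu `]-oo, x]%classic = (H x)%:E.
  exact: (cdf_lebesgue_stieltjes_id cH x).
(* The open ray is the union of the rays ]-oo, -1/(n+1)], each of mass [H (-1/(n+1)) = 0]. *)
have nuneg : nu `]-oo, 0[%classic = 0%E.
  have -> : `]-oo, 0[%classic = \bigcup_n `]-oo, - n.+1%:R^-1 : R]%classic.
    apply/seteqP; split=> x /=; last first.
      case=> n _ /=; rewrite !in_itv/= => /le_lt_trans; apply.
      by rewrite oppr_lt0 invr_gt0.
    rewrite in_itv/= => x0; have [n xn] := ltr_add_invr x0.
    by exists n => //=; rewrite in_itv/= lerNr -subr_le0 opprK addrC ltW.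
  apply/eqP; rewrite -measure_le0.
  have mI n : measurable (`]-oo, - n.+1%:R^-1 : R]%classic : set R).
    exact: measurable_itv.
  apply: (le_trans (measure_sigma_subadditive nu mI _ _)) => //.
    exact: bigcup_measurable.
  rewrite eseries0// => n _ _; apply: etrans (nuE _) _.
  by rewrite H0// oppr_lt0 invr_gt0.
have nusupp : nu `[0, M]%classic = 1%E.
  have := nuE M; rewrite H1//.
  have -> : `]-oo, M]%classic = `]-oo, 0[%classic `|` `[0, M]%classic :> set R.
    by rewrite -itv_bndbnd_setU// ?bnd_simp.
  rewrite measureU//; last first.
    by apply/seteqP; split=> // x [] /=; rewrite !in_itv/= => x0 /andP[]; rewrite leNgt x0.
  by rewrite -[X in (X + _)%E = _ -> _]/(nu `]-oo, 0[%classic) nuneg add0e.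
by exists (MkPM nusupp).
Qed.

(** The ultrafilter makes all distribution functions converge at once, in place of a diagonal
    subsequence. The limit need not be right-continuous, so convergence is claimed only on the dense
    set where it equals its regularization. *)
Lemma helly_ultra (T : Type) (F : set_system T) (mu : T -> PM M) :
  0 <= M -> UltraFilter F ->
  exists nu : PM M, forall a b : R, a < b -> exists2 x : R, a < x < b &
    fine (pm_mu (mu t) `]-oo, x]%classic) @[t --> F] -->
    fine (pm_mu nu `]-oo, x]%classic).
Proof.
move=> M0 UF.
have PF : ProperFilter F by exact: ultra_proper.
pose c t x := fine (pm_mu (mu t) `]-oo, x]%classic).
have fP (m : PM M) (A : set R) : measurable A ->
    ((fine (pm_mu m A))%:E = pm_mu m A)%E.
  by move=> mA; rewrite fineK// fin_num_measure.
have c01 t x : 0 <= c t x <= 1.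
  by apply/andP; split; rewrite -lee_fin fP ?measure_ge0 ?probability_le1//.
have ndc t : {homo c t : x y / x <= y}.
  move=> x y xy; rewrite -lee_fin !fP//; [|exact: measurable_itv..].
  apply: le_measure; rewrite ?inE; [exact: measurable_itv..|].
  by apply: subset_itvl; rewrite bnd_simp.
have c0 t (x : R) : x < 0 -> c t x = 0.
  move=> x0; apply/eqP; rewrite eq_le (andP (c01 t x)).1 andbT -lee_fin fP//.
  have : (pm_mu (mu t) (`]-oo, x]%classic `|` `[0%R, M]%classic) <= 1)%E.
    by apply: probability_le1; apply: measurableU; exact: measurable_itv.
  rewrite measureU; [|exact: measurable_itv..|]; last first.
    apply/seteqP; split=> // y [] /=; rewrite !in_itv/= => yx /andP[].
    by rewrite leNgt (le_lt_trans yx).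
  rewrite [X in (_ + X)%E](_ : _ = 1%E); last exact: pm_supp.
  by rewrite -[X in (_ <= X)%E]add0e leeD2rE.
have c1 t (x : R) : M <= x -> c t x = 1.
  move=> Mx; apply/eqP; rewrite eq_le (andP (c01 t x)).2/= -lee_fin fP//.
  rewrite -(pm_supp (mu t)); apply: le_measure; rewrite ?inE; [exact: measurable_itv..|].
  by apply: subset_itv; rewrite bnd_simp.
have cl x : exists l : R, 0 <= l <= 1 /\ c t x @[t --> F] --> l.
  by have [l l01 cl] := ultra_cvg_itv UF (c01 ^~ x); exists l.
have [G GP] := choice cl.
have G01 x : 0 <= G x by have [/andP[]] := GP x.
have ndG : {homo G : x y / x <= y}.
  move=> x y xy; rewrite -subr_ge0.
  have cB := cvgB (GP y).2 (GP x).2.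
  refine (@closed_cvg T R F PF _ (fun z : R => 0 <= z) (@closed_ge R 0) _ _ (cB _)).
  by apply: nearW => t; rewrite /= subr_ge0; exact: ndc.
have G0 (x : R) : x < 0 -> G x = 0.
  move=> x0; apply: (cvg_unique (@Rhausdorff _) (GP x).2).
  by apply: cvg_near_cst; apply: nearW => t; exact: c0.
have G1 (x : R) : M <= x -> G x = 1.
  move=> x0; apply: (cvg_unique (@Rhausdorff _) (GP x).2).
  by apply: cvg_near_cst; apply: nearW => t; exact: c1.
have H0 (x : R) : x < 0 -> right_reg G x = 0.
  move=> x0; apply/eqP; rewrite eq_le; apply/andP; split.
    (* The point x/2 lies to the right of x and is still negative, so [G] vanishes there. *)
    have x20 : x / 2 < 0 by lra.
    by rewrite -(G0 _ x20); apply: right_reg_le => //; lra.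
  by rewrite -[X in X <= _](G0 _ x0); exact: le_right_reg.
have H1 (x : R) : M <= x -> right_reg G x = 1.
  move=> Mx; apply/eqP; rewrite eq_le; apply/andP; split.
    have Mx1 : M <= x + 1 by lra.
    by rewrite -(G1 _ Mx1); apply: right_reg_le => //; lra.
  by rewrite -[X in X <= _](G1 _ Mx); exact: le_right_reg.
have [nu nuE] := cdf_probability _ (right_reg_nd _ ndG G01)
  (right_reg_rc _ ndG G01) M0 H0 H1.
exists nu => a b ab; have [x axb Hx] := right_reg_dense _ ndG G01 _ _ ab.
by exists x => //; rewrite nuE/= Hx; exact: (GP x).2.
Qed.
End helly.

(** * Convergence of integrals of continuous functions *)

(** Near covering form of compactness: if r is a radius of continuity at x for e/2, then every x'
    within r/2 of x and every d < r/2 work, since y within d of x' is within r of x. *)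
Lemma heine_cantor_itv {R : realType} {a b : R} {f : R -> R} :
  {within `[a, b], continuous f} -> forall e : R, 0 < e ->
  exists2 d : R, 0 < d & forall x y, `[a, b]%classic x -> `[a, b]%classic y ->
    `|x - y| < d -> `|f x - f y| < e.
Proof.
move=> /subspace_continuousP fc e e0.
have /compact_near_coveringP cab := @segment_compact R a b.
pose P (d x : R) := `[a, b]%classic x -> forall y, `[a, b]%classic y ->
  `|x - y| < d -> `|f x - f y| < e.
have /cab : forall x, `[a, b]%classic x -> \forall x' \near x & d \near 0^'+, P d x'.
  move=> x xab.
  have /cvgrPdist_lt/(_ (e / 2) (divr_gt0 e0 (ltr0n _ 2))) := fc x xab.
  rewrite near_withinE => -[r/= r0 rP].
  have fr y : `[a, b]%classic y -> `|x - y| < r -> `|f x - f y| < e / 2.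
    by move=> yab xy; exact: rP.
  exists (ball x (r / 2), [set d | d < r / 2]) => /=.
    split; first by apply: nbhsx_ballx; rewrite divr_gt0.
    by apply: nbhs_right_lt; rewrite divr_gt0.
  move=> [x' d]/= [xx' dr] x'ab y yab x'y.
  have xx'r : `|x - x'| < r / 2 by [].
  have h1 : `|f x - f x'| < e / 2 by apply: fr => //; lra.
  have h2 : `|f x - f y| < e / 2.
    by apply: fr => //; have := ler_distD x' x y; lra.
  by have := ler_distD (f x) (f x') (f y); rewrite [`|f x' - f x|]distrC; lra.
move=> Pd.
have [d [d0 dP]] : exists d, 0 < d /\ `[a, b]%classic `<=` P d.
  have : \forall d \near 0^'+, 0 < d /\ `[a, b]%classic `<=` P d.
    by near=> d; split; [near: d; exact: nbhs_right_gt|near: d].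
  by move=> /filter_ex[d]; exists d.
by exists d => // x y xab yab; exact: dP.
Unshelve. all: by end_near. Qed.

Section weak_convergence.
Context {R : realType} {M : R}.
Local Notation D := (`[0, M]%classic : set R).
Local Notation I mu g := (\int[pm_mu mu]_(t in D) g t).

Lemma pm_setI (mu : PM M) (A : set R) : measurable A ->
  pm_mu mu (A `&` D) = pm_mu mu A.
Proof.
move=> mA; have mD : measurable D by exact: measurable_itv.
rewrite [RHS](measureDI _ mA mD) [X in (X + _)%E](_ : _ = 0%E) ?add0e//.
apply/eqP; rewrite -measure_le0.
have : pm_mu mu (~` D) = 0%E by rewrite probability_setC// pm_supp subee.
move=> <-; apply: le_measure; rewrite ?inE; [exact: measurableD|exact: measurableC|].
by move=> x [].
Qed.

(** A class holding both the continuous functions on [0, M] and their step approximations, and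
    integrable against every measure in [PM M]. *)
Definition bounded_measurable (g : R -> R) :=
  measurable_fun D g /\ exists C, forall t, D t -> `|g t| <= C.

Lemma within_continuous_bounded_measurable (f : R -> R) :
  {within D, continuous f} -> bounded_measurable f.
Proof.
move=> fc; split.
  by apply: subspace_continuous_measurable_fun => //; exact: measurable_itv.
have /compact_bounded[C [_ CP]] := continuous_compact fc (@segment_compact _ _ _).
by exists (C + 1) => t Dt; apply: (CP (C + 1)); [rewrite ltrDl|exists t].
Qed.

Lemma bounded_measurable_integrable (mu : PM M) (g : R -> R) :
  bounded_measurable g -> (pm_mu mu).-integrable D (EFin \o g).
Proof.
move=> [mg [C gC]].
have muD : (pm_mu mu D < +oo)%E by rewrite pm_supp ltry.
apply: measurable_bounded_integrable => //.
exists C; split; first exact: num_real.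
by move=> x Cx t Dt; exact: le_trans (gC _ Dt) (ltW Cx).
Qed.

(** Since [mu] has mass 1 on [0, M], uniform approximation carries over to integrals with the same
    error for all [mu]. *)
Lemma Rintegral_dist_le (mu : PM M) (f g : R -> R) (e : R) : 0 <= e ->
  bounded_measurable f -> bounded_measurable g ->
  (forall t, D t -> `|f t - g t| <= e) -> `|I mu f - I mu g| <= e.
Proof.
move=> e0 bf bg fg.
have mD : measurable D by exact: measurable_itv.
have fi := bounded_measurable_integrable mu _ bf.
have gi := bounded_measurable_integrable mu _ bg.
have fgi : (pm_mu mu).-integrable D (EFin \o (fun t => f t - g t)).
  by rewrite (_ : _ \o _ = ((EFin \o f) \- (EFin \o g))%E)//; exact: integrableB.
rewrite -RintegralB//; apply: le_trans (le_normr_Rintegral mD fgi) _.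
have ei : (pm_mu mu).-integrable D (EFin \o cst e).
  apply: bounded_measurable_integrable; split; first exact: measurable_cst.
  by exists `|e|.
apply: le_trans (le_Rintegral mD _ ei _) _ => //.
  exact: (integrable_abse fgi).
by rewrite Rintegral_cst// [X in fine X](_ : _ = 1%E) ?mulr1//; exact: pm_supp.
Qed.

Lemma Rintegral_ray (mu : PM M) (x : R) :
  I mu (\1_`]-oo, x]) = fine (pm_mu mu `]-oo, x]%classic).
Proof.
rewrite /Rintegral integral_indic//; [|exact: measurable_itv..].
by congr fine; apply: pm_setI; exact: measurable_itv.
Qed.

Lemma ray_bounded_measurable (x : R) : bounded_measurable (\1_`]-oo, x]).
Proof.
split; first by apply: measurable_indic; exact: measurable_itv.
by exists 1 => t _; rewrite indicE; case: (_ \in _); rewrite ?normr1 ?normr0.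
Qed.

Section cdf_cvg.
Context {T : Type} {F : set_system T} {PF : ProperFilter F}.
Context {mu : T -> PM M} {nu : PM M}.

Let good (x : R) := fine (pm_mu (mu t) `]-oo, x]%classic) @[t --> F] -->
  fine (pm_mu nu `]-oo, x]%classic).

Let int_cvg (g : R -> R) :=
  bounded_measurable g /\ I (mu t) g @[t --> F] --> I nu g.

Let int_cvg_step g x c : int_cvg g -> good x ->
  int_cvg (fun t => g t + c * \1_`]-oo, x] t).
Proof.
move=> [bg gc] gx; have bx := ray_bounded_measurable x.
have bcx : bounded_measurable (fun t => c * \1_`]-oo, x] t).
  split; first exact: measurable_funM (measurable_cst _) bx.1.
  have [C xC] := bx.2; exists (`|c| * C) => t Dt.
  by rewrite normrM ler_wpM2l// xC.
have mD : measurable D by exact: measurable_itv.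
have IE (m : PM M) : I m (fun t => g t + c * \1_`]-oo, x] t) =
    I m g + c * fine (pm_mu m `]-oo, x]%classic).
  have gi := bounded_measurable_integrable m _ bg.
  have ci := bounded_measurable_integrable m _ bcx.
  have xi := bounded_measurable_integrable m _ bx.
  rewrite RintegralD//.
  by rewrite RintegralZl// Rintegral_ray.
split.
  split; first by apply: measurable_funD; [exact: bg.1|exact: bcx.1].
  have [[_ [C gC]] [_ [C' xC]]] := (bg, bcx); exists (C + C') => t Dt.
  by rewrite (le_trans (ler_normD _ _))// lerD ?gC ?xC.
under eq_fun do rewrite IE; rewrite IE.
by apply: cvgD => //; apply: cvgM => //; exact: cvg_cst.
Qed.

(** Integrals of ray indicators are values of the distribution function, so step functions jumping
    at good points have convergent integrals. Uniform approximation by them transfers this to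
    continuous functions. *)
Lemma cdf_cvg_Rintegral :
  (forall a b : R, a < b -> exists2 x, a < x < b & good x) -> 0 <= M ->
  forall f : R -> R, {within D, continuous f} ->
  I (mu t) f @[t --> F] --> I nu f.
Proof.
move=> dense M0 f fc; have bf := within_continuous_bounded_measurable _ fc.
have approx (e : R) : 0 < e ->
    exists2 g, int_cvg g & forall t, D t -> `|f t - g t| <= e.
  move=> e0; have [d d0 fd] := heine_cantor_itv fc _ e0.
  pose h := d / 2.
  have h0 : 0 < h by rewrite divr_gt0.
  (* The step function is built from left to right: [g] is already e-close to [f] up to the last
     jump x and is 0 beyond it. One jump per cell of length h = d/2 keeps consecutive jumps less
     than d apart. The initial x is negative, so the empty step function qualifies. *)
  have step k : exists x g, [/\ (k%:R - 1) * h < x < k%:R * h, good x, int_cvg g,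
      (forall t, D t -> t <= x -> `|f t - g t| <= e) &
      (forall t, x < t -> g t = 0)].
    elim: k => [|k [x [g [/andP[xk kx] gx cg fg g0]]]].
      have [|x /andP[x1 x2] gx] := dense ((0 - 1) * h) (0 * h); first lra.
      exists x, (cst 0); split => //; first by rewrite x1 x2.
        split; first by split; [exact: measurable_cst|exists 0 => t _; rewrite normr0].
        rewrite Rintegral_cst; [|exact: measurable_itv].
        by under eq_fun do rewrite Rintegral_cst//= mul0r; rewrite mul0r; exact: cvg_cst.
      move=> t /=; rewrite in_itv/= => /andP[t0 _] tx; lra.
    have k1 : k.+1%:R = k%:R + 1 :> R by rewrite -natr1.
    have [|x' /andP[x1 x2] gx'] := dense (k%:R * h) (k.+1%:R * h).
      by rewrite k1; nra.
    (* The new jump x' may exceed M, so [f] is sampled at x' clamped to [0, M]; clamping does not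
       increase the distance to points of [0, M]. The two ray terms below add c exactly on ]x,
       x']. *)
    pose c := f (Num.max 0 (Num.min x' M)).
    exists x', (fun t => (g t + c * \1_`]-oo, x'] t) + (- c) * \1_`]-oo, x] t); split.
    - by rewrite x2 k1 addrK x1.
    - by [].
    - by apply: int_cvg_step => //; exact: int_cvg_step.
    - move=> t Dt tx'; rewrite !indicE !mem_setE !in_itv/= tx' mulr1.
      have [tx|xt] := leP t x; first by rewrite mulr1 addrK fg.
      rewrite mulr0 addr0 g0// add0r; apply/ltW/fd => //.
        rewrite /= in_itv/=; apply/andP; split; first by rewrite le_max lexx.
        by rewrite ge_max M0 ge_min lexx orbT.
      move: Dt; rewrite /= in_itv/= => /andP[t0 tM].
      rewrite ltr_norml.
      have : x' - x < d.
        have : x' - x < k.+1%:R * h - (k%:R - 1) * h by lra.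
        by rewrite k1 /h; lra.
      move=> x'x.
      by case: (leP x' M) => x'M; case: (leP 0 _) => y0; apply/andP; split; lra.
    - move=> t x't; have xt : x < t by lra.
      rewrite g0// !indicE !mem_setE !in_itv/= !leNgt x't xt/=.
      by rewrite !mulr0 !addr0.
  (* After this many cells the last jump exceeds [Num.bound (M / h)] times h, hence M, so [g]
     approximates [f] on all of [0, M]. *)
  have [x [g [/andP[xk _] _ cg fg _]]] := step (Num.bound (M / h)).+1.
  exists g => // t Dt; apply: fg => //.
  move: Dt; rewrite /= in_itv/= => /andP[t0 tM].
  have := archi_boundP (divr_ge0 M0 (ltW h0)).
  rewrite ltr_pdivrMr// => Mh; move: xk; rewrite -natr1 addrK; lra.
apply/cvgrPdist_le => e e0.
have e3 : 0 < e / 3 by rewrite divr_gt0.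
have [g [bg gc] fg] := approx _ e3.
have /cvgrPdist_le/(_ _ e3) := gc; apply: filterS => t ht.
have h1 := Rintegral_dist_le nu _ _ _ (ltW e3) bf bg fg.
have h2 := Rintegral_dist_le (mu t) _ _ _ (ltW e3) bf bg fg.
have := ler_distD (I nu g) (I nu f) (I (mu t) f).
have := ler_distD (I (mu t) g) (I nu g) (I (mu t) f).
by rewrite [`|I (mu t) g - _|]distrC; lra.
Qed.

End cdf_cvg.
End weak_convergence.

(** * Weak compactness and truncated inverse powers *)

Section topology.

Lemma cvg_initial_topology (S : choiceType) (T : topologicalType) (f : S -> T)
    (F : set_system S) (s : S) : Filter F ->
  f @ F --> f s -> F --> (s : initial_topology f).
Proof.
move=> FF fF A [_ [[B oB <-] Bfs BA]].
by apply: (@filterS _ F _ _ _ BA); apply: fF; exact: open_nbhs_nbhs.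
Qed.

Lemma eval_continuous (I : Type) (K : I -> topologicalType) (i : I) :
  continuous (fun f : prod_topology K => f i).
Proof.
move=> f A fA.
have /cvg_sup/(_ i) fi : nbhs f --> (f : prod_topology K) by exact: cvg_id.
exact/fi/(@initial_continuous _ _ (fun g : (forall i, K i) => g i) f).
Qed.

End topology.

Section weak_compactness.
Context {R : realType} {M : R}.

Lemma PMw_compact : 0 <= M -> compact [set: PMw M].
Proof.
move=> M0; rewrite compact_ultra => F UF _.
have PF : ProperFilter F by exact: ultra_proper.
have [nu nuP] := helly_ultra _ F (fun m : PMw M => m : PM M) M0 UF.
exists nu; split=> //; apply: cvg_initial_topology.
(* The topology is initial for [pm_eval] and then for the coordinates of the product, so it remains
   to treat the integral of a single continuous f. *)
apply/cvg_sup => f; apply: cvg_initial_topology.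
exact: (cdf_cvg_Rintegral nuP M0 _ (proj2_sig f)).
Qed.

Lemma pm_eval_continuous (eta : option nat) (i : idx eta) (f : CF M) :
  continuous (fun mu : PMprod M eta => pm_eval (mu i : PM M) f : R).
Proof.
move=> mu.
apply: (@continuous_comp _ _ _ (fun mu : PMprod M eta => mu i)
  (fun m : PMw M => pm_eval (m : PM M) f)); first exact: eval_continuous.
apply: (@continuous_comp _ _ _ (@pm_eval R M : PMw M -> _)
  (fun g : prod_topology (fun _ : CF M => (R : topologicalType)) => g f)).
  exact: initial_continuous.
exact: eval_continuous.
Qed.

End weak_compactness.

Section truncated_inverse_power.
Context {R : realType}.

(** Bounding t from below inside the inverse gives a function continuous on the whole line,
    including at 0. *)
Definition inv_pow_trunc (k N : nat) (t : R) : R :=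
  ((Num.max t N.+1%:R^-1)^-1) ^+ k.+1.

Lemma inv_pow_trunc_continuous k N : continuous (inv_pow_trunc k N).
Proof.
move=> t; apply: (@continuous_comp R R R (fun t : R => (Num.max t N.+1%:R^-1)^-1)
  (fun x : R => x ^+ k.+1)); last exact: exprn_continuous.
apply: continuousV; first by rewrite gt_eqF// lt_max invr_gt0 ltr0n orbT.
rewrite (_ : (fun _ => _) =
    (fun x => (x + N.+1%:R^-1 + `|x - N.+1%:R^-1|) / 2)); last first.
  by apply/funext => x; rewrite maxr_absE.
apply: cvgM; last exact: cvg_cst.
apply: cvgD; first by apply: cvgD; [exact: cvg_id|exact: cvg_cst].
by apply: cvg_norm; apply: cvgB; [exact: cvg_id|exact: cvg_cst].
Qed.

Lemma inv_pow_trunc_ge0 k N (t : R) : 0 <= inv_pow_trunc k N t.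
Proof. by rewrite exprn_ge0// invr_ge0 le_max invr_ge0 ler0n orbT. Qed.

Lemma inv_pow_trunc_le k N (t : R) : inv_pow_trunc k N t <= N.+1%:R ^+ k.+1.
Proof.
rewrite lerXn2r ?nnegrE ?invr_ge0 ?le_max ?invr_ge0 ?ler0n ?orbT//.
by rewrite invf_ple ?posrE ?ltr0n ?lt_max ?invr_gt0 ?ltr0n ?orbT// le_max lexx orbT.
Qed.

Lemma inv_pow_trunc_nd k (t : R) :
  {homo (inv_pow_trunc k ^~ t) : n m / (n <= m)%N >-> n <= m}.
Proof.
move=> n m nm.
rewrite lerXn2r ?nnegrE ?invr_ge0 ?le_max ?invr_ge0 ?ler0n ?orbT//.
rewrite lef_pV2 ?posrE ?lt_max ?invr_gt0 ?ltr0n ?orbT//.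
rewrite ge_max !le_max lexx/=; apply/orP; right.
by rewrite lef_pV2 ?posrE ?ltr0n// ler_nat.
Qed.

Lemma inv_pow_truncE k N (t : R) : N.+1%:R^-1 <= t ->
  (inv_pow_trunc k N t)%:E = inv_pow k t.
Proof.
move=> Nt; rewrite /inv_pow gt_eqF; last first.
  by apply: lt_le_trans Nt; rewrite invr_gt0.
by rewrite /inv_pow_trunc max_l.
Qed.

Lemma inv_pow_trunc_cvg k (t : R) : 0 <= t ->
  (inv_pow_trunc k N t)%:E @[N --> \oo] --> inv_pow k t.
Proof.
rewrite le_eqVlt => /predU1P[<-|t0].
  (* At t = 0 the truncation equals (N+1)^(k+1) >= N+1, which tends to the prescribed value +oo. For
     t > 0 it is constant as soon as N >= 1/t. *)
  rewrite /inv_pow eqxx; apply/cvgeryP/cvgryPge => A.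
  near=> N.
  rewrite /inv_pow_trunc max_r ?invr_ge0// invrK.
  have AN : A <= N.+1%:R.
    rewrite -natr1; apply: (@le_trans _ _ N%:R); last by rewrite lerDl.
    by near: N; exact: nbhs_infty_ger.
  apply: le_trans AN _.
  by rewrite exprS ler_peMr// exprn_ege1// ler1n.
apply: cvg_near_cst; near=> N; apply: inv_pow_truncE.
rewrite invf_ple ?posrE ?ltr0n//.
rewrite -natr1; apply: (@le_trans _ _ N%:R); last by rewrite lerDl.
by near: N; exact: nbhs_infty_ger.
Unshelve. all: by end_near. Qed.

Lemma inv_pow_ge0 k (t : R) : 0 <= t -> (0 <= inv_pow k t)%E.
Proof.
move=> t0; rewrite /inv_pow; case: ifPn => // _.
by rewrite lee_fin exprn_ge0// invr_ge0.
Qed.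

(** For t >= 1/(N+1) the truncation is exact. Below that level t^(-k-1) = t^(kappa-k) t^(-kappa-1),
    and t^(kappa-k) <= t < 1/(N+1) because k < kappa and t <= 1. At t = 0 the last term is +oo. *)
Lemma inv_pow_le_trunc k kappa N (t : R) : (k < kappa)%N -> 0 <= t ->
  (inv_pow k t <= (inv_pow_trunc k N t)%:E + N.+1%:R^-1%:E * inv_pow kappa t)%E.
Proof.
move=> kk t0; have [Nt|tN] := leP N.+1%:R^-1 t.
  rewrite -(inv_pow_truncE k N)// leeDl// mule_ge0 ?inv_pow_ge0//.
apply: (@le_trans _ _ (N.+1%:R^-1%:E * inv_pow kappa t)%E); last first.
  by rewrite leeDr// lee_fin inv_pow_trunc_ge0.
rewrite /inv_pow; case: ifPn => [_|tn0].
  by rewrite gt0_muley// lte_fin invr_gt0 ltr0n.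
have {tn0}t0 : 0 < t by rewrite lt_neqAle eq_sym tn0.
have -> : kappa.+1 = ((kappa - k.+1).+1 + k.+1)%N by rewrite addSn subnK.
rewrite -EFinM lee_fin exprD mulrA.
rewrite ler_peMl ?exprn_ge0 ?invr_ge0 ?(ltW t0)// exprS mulrA.
have Nt1 : 1 <= N.+1%:R^-1 * t^-1 by rewrite ler_pdivlMr// mul1r ltW.
apply: mulr_ege1 => //; rewrite exprn_ege1// invf_ge1//.
by rewrite (le_trans (ltW tN))// invf_le1// ler1n.
Qed.

Context {M : R}.
Local Notation D := (`[0, M]%classic : set R).

Definition inv_pow_trunc_CF k N : CF M :=
  exist _ (inv_pow_trunc k N)
    (continuous_subspaceT (@inv_pow_trunc_continuous k N)).

Lemma pm_eval_truncE (m : PM M) k N :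
  ((pm_eval m (inv_pow_trunc_CF k N))%:E =
   \int[pm_mu m]_(t in D) (inv_pow_trunc k N t)%:E)%E.
Proof.
rewrite /pm_eval fineK//; apply: integrable_fin_num => //.
apply: bounded_measurable_integrable.
exact/within_continuous_bounded_measurable/continuous_subspaceT/inv_pow_trunc_continuous.
Qed.

Let mh k N : measurable_fun D (fun t => (inv_pow_trunc k N t)%:E).
Proof.
apply/measurable_EFinP/measurable_funTS.
by apply: continuous_measurable_fun; exact: inv_pow_trunc_continuous.
Qed.

Let D0 t : D t -> 0 <= t.
Proof. by rewrite /= in_itv/= => /andP[]. Qed.

Lemma inv_pow_measurable k : measurable_fun D (@inv_pow R k).
Proof.
apply: (emeasurable_fun_cvg (fun N t => (inv_pow_trunc k N t)%:E)) => //.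
by move=> t /D0; exact: inv_pow_trunc_cvg.
Qed.

Lemma pm_eval_trunc_cvg (m : PM M) k :
  (pm_eval m (inv_pow_trunc_CF k N))%:E @[N --> \oo] -->
  (\int[pm_mu m]_(t in D) inv_pow k t)%E.
Proof.
under eq_fun do rewrite pm_eval_truncE.
have -> : (\int[pm_mu m]_(t in D) inv_pow k t =
    \int[pm_mu m]_(t in D) limn (fun N => (inv_pow_trunc k N t)%:E))%E.
  apply: eq_integral => t /[!inE] /D0 t0; apply/esym/cvg_lim => //.
  exact: inv_pow_trunc_cvg.
apply: cvg_monotone_convergence => //.
- by move=> n t _; rewrite lee_fin inv_pow_trunc_ge0.
- by move=> t _ n n' nn'; rewrite lee_fin inv_pow_trunc_nd.
Qed.

Lemma pm_eval_trunc_ge0 (m : PM M) k N : 0 <= pm_eval m (inv_pow_trunc_CF k N).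
Proof. by rewrite Rintegral_ge0// => t _; exact: inv_pow_trunc_ge0. Qed.

Lemma pm_eval_trunc_ub (m : PM M) k N :
  pm_eval m (inv_pow_trunc_CF k N) <= N.+1%:R ^+ k.+1.
Proof.
rewrite -lee_fin pm_eval_truncE.
have -> : (N.+1%:R ^+ k.+1)%:E =
    (\int[pm_mu m]_(t in D) (cst (N.+1%:R ^+ k.+1)%:E) t)%E :> \bar R.
  rewrite integral_cst//.
  by rewrite [X in (_ * X)%E](_ : _ = 1%E) ?mule1//; exact: pm_supp.
apply: ge0_le_integral => //.
- by move=> t _; rewrite lee_fin inv_pow_trunc_ge0.
- by move=> t _; rewrite lee_fin inv_pow_trunc_le.
Qed.

Lemma pm_eval_trunc_le (m : PM M) k N :
  ((pm_eval m (inv_pow_trunc_CF k N))%:E <= \int[pm_mu m]_(t in D) inv_pow k t)%E.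
Proof.
rewrite pm_eval_truncE; apply: ge0_le_integral => //.
- by move=> t _; rewrite lee_fin inv_pow_trunc_ge0.
- exact: inv_pow_measurable.
move=> t /D0 t0; have ic := inv_pow_trunc_cvg k _ t0.
rewrite -(cvg_lim _ ic)//; apply: lime_ge; first by apply/cvg_ex; exists (inv_pow k t).
near=> n; rewrite lee_fin; apply: inv_pow_trunc_nd.
by near: n; exact: nbhs_infty_ge.
Unshelve. all: by end_near. Qed.

Lemma integral_inv_pow_ge0 (m : PM M) k :
  (0 <= \int[pm_mu m]_(t in D) inv_pow k t)%E.
Proof. by apply: integral_ge0 => t /D0; exact: inv_pow_ge0. Qed.

Lemma integral_inv_pow_le (m : PM M) k kappa N : (k < kappa)%N ->
  (\int[pm_mu m]_(t in D) inv_pow k t <=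
   (pm_eval m (inv_pow_trunc_CF k N))%:E +
   N.+1%:R^-1%:E * \int[pm_mu m]_(t in D) inv_pow kappa t)%E.
Proof.
move=> kk; rewrite pm_eval_truncE.
have mi := inv_pow_measurable kappa.
have i0 t : D t -> (0 <= inv_pow kappa t)%E by move=> /D0; exact: inv_pow_ge0.
have N0 : 0 <= N.+1%:R^-1 :> R by rewrite invr_ge0.
rewrite -ge0_integralZl_EFin//.
rewrite -ge0_integralD//; last 3 first.
- by move=> t _; rewrite lee_fin inv_pow_trunc_ge0.
- by move=> t Dt; rewrite mule_ge0// i0.
- exact: measurable_funeM.
apply: ge0_le_integral => //.
- by move=> t /D0; exact: inv_pow_ge0.
- exact: inv_pow_measurable.
- by apply: emeasurable_funD => //; exact: measurable_funeM.
- by move=> t /D0; exact: inv_pow_le_trunc.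
Qed.

End truncated_inverse_power.

(** * Closedness of the constraints *)

Section esum_lemmas.
Context {R : realType} {I : choiceType}.
Implicit Types a : I -> \bar R.

Lemma le_esumP a (c : \bar R) :
  (\esum_(i in [set: I]) a i <= c)%E <->
  (forall X, finite_set X -> (\sum_(i \in X) a i)%R <= c)%E.
Proof.
split=> [ac X fX|ac].
  by apply: le_trans ac; apply: esum_ge; exists X.
by apply: ge_ereal_sup => _ [X [fX _] <-]; exact: ac.
Qed.

Lemma esumZ_le a (r : R) (c : \bar R) : 0 <= r -> (forall i, 0 <= a i)%E ->
  (\esum_(i in [set: I]) a i <= c)%E ->
  (\esum_(i in [set: I]) (r%:E * a i) <= r%:E * c)%E.
Proof.
move=> r0 a0 /le_esumP ac; apply/le_esumP => X fX.
by rewrite -ge0_mule_fsumr// lee_wpmul2l ?lee_fin// ac.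
Qed.

(** A finite X whose sum is within e of the supremum leaves at most e for its complement; finiteness
    of the total permits the subtraction. *)
Lemma esum_tail a (e : R) : 0 < e -> (forall i, 0 <= a i)%E ->
  (\esum_(i in [set: I]) a i < +oo)%E ->
  exists2 X, finite_set X & (\esum_(i in ~` X) a i <= e%:E)%E.
Proof.
move=> e0 a0 ay.
have afin : \esum_(i in [set: I]) a i \is a fin_num.
  by rewrite ge0_fin_numE// esum_ge0.
have [_ [X [fX _] <-]] := ub_ereal_sup_adherent e0 afin.
rewrite -/(esum setT a) => aX; exists X => //.
move: aX afin; rewrite (esumID X)// !setTI (esum_fset fX)//.
rewrite fin_numD => /[swap] /andP[Xf].
case: (\esum_(i in ~` X) a i)%E => // r _.
rewrite -(fineK Xf) -EFinN -!EFinD lte_fin lee_fin; lra.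
Qed.

End esum_lemmas.

(** * Weighted sums of inverse moments over the branches *)

Section branch_sums.
Context {R : realType} {M : R} {eta : option nat} (w : idx eta -> R).
Hypothesis w0 : forall i, 0 <= w i.
Local Notation D := (`[0, M]%classic : set R).

Definition branch_sum k (mu : PMprod M eta) : \bar R :=
  (\esum_(i in [set: idx eta])
    ((w i)%:E * \int[measure_of (mu i)]_(t in D) inv_pow k t)%E)%R.

(** Truncates twice, to finitely many branches and to a bounded integrand, so that the result is
    continuous in [mu]. *)
Definition branch_trunc k N X (mu : PMprod M eta) : R :=
  \sum_(i \in X) w i * pm_eval (mu i : PM M) (inv_pow_trunc_CF k N).

Lemma branch_trunc_continuous k N X : finite_set X ->
  continuous (branch_trunc k N X).
Proof.
move=> fX.
pose T (s : seq (idx eta)) (mu : PMprod M eta) : R :=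
  \sum_(i <- s) w i * pm_eval (mu i : PM M) (inv_pow_trunc_CF k N).
have -> : branch_trunc k N X = T (finmap.enum_fset (fset_set X)).
  by apply/funext => mu; rewrite /branch_trunc fsbig_finite.
elim: (finmap.enum_fset _) => [|i s IH] mu.
  have -> : T [::] = cst 0 by apply/funext => nu; rewrite /T big_nil.
  exact: cst_continuous.
have -> : T (i :: s) =
    (fun nu => w i * pm_eval (nu i : PM M) (inv_pow_trunc_CF k N) + T s nu).
  by apply/funext => nu; rewrite /T big_cons.
have pc := pm_eval_continuous eta i (inv_pow_trunc_CF k N) mu.
exact: cvgD (cvgM (cvg_cst (w i)) pc) (IH mu).
Qed.

Let term_ge0 (m : PM M) i k :
  (0 <= (w i)%:E * \int[pm_mu m]_(t in D) inv_pow k t)%E.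
Proof. by rewrite mule_ge0 ?integral_inv_pow_ge0// lee_fin. Qed.

Let branch_truncE k N X mu : finite_set X -> ((branch_trunc k N X mu)%:E =
  (\sum_(i \in X) ((w i)%:E * (pm_eval (mu i : PM M) (inv_pow_trunc_CF k N))%:E)%E)%R)%E.
Proof. by move=> fX; rewrite -fsumEFin. Qed.

Lemma branch_trunc_le k N X mu : finite_set X ->
  ((branch_trunc k N X mu)%:E <= branch_sum k mu)%E.
Proof.
move=> fX; apply: esum_ge; exists X => //; rewrite branch_truncE//.
by apply: lee_fsum => // i _; rewrite lee_wpmul2l ?lee_fin//; exact: pm_eval_trunc_le.
Qed.

(** For fixed finite X the truncated sums converge to the sum of the integrals as N grows, and the
    full sum is the supremum over X. The sublevel set is thus an intersection of closed
    conditions. *)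
Lemma branch_sum_leP k (c : R) mu : (branch_sum k mu <= c%:E)%E <->
  (forall N X, finite_set X -> branch_trunc k N X mu <= c).
Proof.
split=> [Sc N X fX|Tc].
  by rewrite -lee_fin; apply: le_trans Sc; exact: branch_trunc_le.
apply/le_esumP => X fX.
have : (branch_trunc k N X mu)%:E @[N --> \oo] -->
    (\sum_(i \in X) ((w i)%:E * \int[measure_of (mu i)]_(t in D) inv_pow k t)%E)%R.
  rewrite fsbig_finite//=.
  under eq_fun do rewrite branch_truncE// fsbig_finite//=.
  apply: cvg_nnesum => i _.
    by apply: nearW => N; rewrite mule_ge0 ?lee_fin ?pm_eval_trunc_ge0.
  by apply: cvgeZl => //; exact: pm_eval_trunc_cvg.
move=> /[dup] Tcvg /cvg_lim <-//; apply: lime_le; first by apply/cvg_ex; eexists; exact: Tcvg.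
by apply: nearW => N; rewrite lee_fin Tc.
Qed.

Lemma branch_sum_le_closed k (c : R) :
  closed [set mu | (branch_sum k mu <= c%:E)%E].
Proof.
have -> : [set mu | (branch_sum k mu <= c%:E)%E] =
    \bigcap_(NX in [set NX : nat * set (idx eta) | finite_set NX.2])
      (branch_trunc k NX.1 NX.2 @^-1` [set x | x <= c]).
  apply/seteqP; split=> mu.
    by move=> /branch_sum_leP Tc [N X] /= fX; exact: Tc.
  by move=> Tc; apply/branch_sum_leP => N X fX; exact: (Tc (N, X) fX).
apply: closed_bigI => -[N X]/= fX.
by have /continuous_closedP := branch_trunc_continuous k N X fX; apply; exact: closed_le.
Qed.

Hypothesis w_summable : (\esum_(i in [set: idx eta]) (w i)%:E < +oo)%E.

(** N and X do not depend on [mu]. First N makes the kappa-term at most c/(N+1) <= e/2. Then the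
    truncated integrals are at most C = (N+1)^(k+1), and X leaves a tail of C w of at most e/2. *)
Lemma branch_sum_approx k kappa (c e : R) : (k < kappa)%N -> 0 <= c -> 0 < e ->
  exists N X, finite_set X /\ forall mu, (branch_sum kappa mu <= c%:E)%E ->
    (branch_sum k mu <= (branch_trunc k N X mu)%:E + e%:E)%E.
Proof.
move=> kk c0 e0; have e20 : 0 < e / 2 by rewrite divr_gt0.
pose N := Num.bound (c / (e / 2)).
have cN : N.+1%:R^-1 * c <= e / 2.
  rewrite mulrC ler_pdivrMr// mulrC -ler_pdivrMr//.
  apply: le_trans (ltW (archi_boundP (divr_ge0 c0 (ltW e20)))) _.
  by rewrite ler_nat.
pose C : R := N.+1%:R ^+ k.+1.
have C0 : 0 <= C by rewrite exprn_ge0.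
have [] := @esum_tail _ _ (fun i => C%:E * (w i)%:E)%E _ e20.
- by move=> i; rewrite mule_ge0// lee_fin.
- apply: (@le_lt_trans _ _ (C%:E * \esum_(i in [set: idx eta]) (w i)%:E)%E).
    by apply: esumZ_le.
  by rewrite lte_mul_pinfty ?lee_fin.
move=> X fX tailX; exists N, X; split=> // mu Sc.
pose J i := ((w i)%:E * (pm_eval (mu i : PM M) (inv_pow_trunc_CF k N))%:E)%E.
pose K i := ((w i)%:E * \int[measure_of (mu i)]_(t in D) inv_pow kappa t)%E.
have J0 i : (0 <= J i)%E by rewrite mule_ge0 ?lee_fin ?pm_eval_trunc_ge0.
have K0 i : (0 <= K i)%E by exact: term_ge0.
apply: (@le_trans _ _ (\esum_(i in [set: idx eta]) (J i + N.+1%:R^-1%:E * K i)%E)).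
  apply: le_esum => i _.
  rewrite /K muleCA -ge0_muleDr//.
  - by apply: lee_wpmul2l; rewrite ?lee_fin//; exact: integral_inv_pow_le.
  - by rewrite lee_fin pm_eval_trunc_ge0.
  - by rewrite mule_ge0 ?integral_inv_pow_ge0.
rewrite esumD//; last by move=> i _; rewrite mule_ge0.
rewrite (splitr e) EFinD addeA; apply: leeD.
  rewrite (esumID X)// !setTI (esum_fset fX)// branch_truncE//.
  apply: leeD => //; apply: le_trans tailX; apply: le_esum => i _.
  by rewrite /J muleC lee_wpmul2r ?lee_fin//; exact: pm_eval_trunc_ub.
apply: le_trans (esumZ_le _ _ _ _ K0 Sc) _; first by rewrite invr_ge0.
by rewrite -EFinM lee_fin.
Qed.

(** Being a supremum of continuous functions yields closed upper bounds only. The lower bound on S_k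
    becomes closed through the uniform approximation on {S_kappa <= c}: there it says that the
    e-approximant is at least d - e for every e > 0. *)
Lemma branch_sum_eq_closed k kappa (c d : R) : (k < kappa)%N -> 0 <= c ->
  closed [set mu | (branch_sum kappa mu <= c%:E)%E /\ branch_sum k mu = d%:E].
Proof.
move=> kk c0.
(* The pair [(0, set0)] for e <= 0 is a dummy that makes the choice function total. *)
have approx (e : R) : exists NX : nat * set (idx eta), 0 < e -> finite_set NX.2 /\
    forall mu, (branch_sum kappa mu <= c%:E)%E ->
      (branch_sum k mu <= (branch_trunc k NX.1 NX.2 mu)%:E + e%:E)%E.
  have [e0|e0] := ltP 0 e; last by exists (0%N, set0).
  by have [N [X NX]] := branch_sum_approx k kappa c e kk c0 e0; exists (N, X).
have [NX NXP] := choice approx.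
have -> : [set mu | (branch_sum kappa mu <= c%:E)%E /\ branch_sum k mu = d%:E] =
    [set mu | (branch_sum kappa mu <= c%:E)%E] `&`
    ([set mu | (branch_sum k mu <= d%:E)%E] `&`
     \bigcap_(e in [set e : R | 0 < e])
       (branch_trunc k (NX e).1 (NX e).2 @^-1` [set x | d - e <= x])).
  apply/seteqP; split=> mu /=.
    move=> [Sc Sd]; split=> //; split; first by rewrite Sd.
    move=> e /= e0; have := (NXP e e0).2 mu Sc.
    by rewrite Sd -EFinD lee_fin lerBlDr.
  move=> [Sc [Sd Td]]; split=> //; apply/eqP; rewrite eq_le Sd/=.
  apply/lee_addgt0Pr => e e0.
  have [fX _] := NXP e e0.
  apply: (@le_trans _ _ ((branch_trunc k (NX e).1 (NX e).2 mu)%:E + e%:E)%E).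
    by rewrite -EFinD lee_fin -lerBlDr; exact: Td.
  by rewrite leeD2r// branch_trunc_le.
apply: closedI; first exact: branch_sum_le_closed.
apply: closedI; first exact: branch_sum_le_closed.
apply: closed_bigI => e /= e0; have [fX _] := NXP e e0.
by have /continuous_closedP := branch_trunc_continuous k (NX e).1 _ fX; apply; exact: closed_ge.
Qed.

End branch_sums.

(** * Moment conditions, summability of the weights and conclusion *)

Lemma moment_closed {R : realType} {M : R} {eta : option nat} (i : idx eta)
    (n : nat) (c : R) :
  closed [set mu : PMprod M eta |
    c%:E = \int[measure_of (mu i)]_(t in `[0%R, M]%classic) (t ^+ n)%R%:E]%E.
Proof.
have xc : {within `[0, M]%classic, continuous (fun t : R => t ^+ n)}.
  by apply: continuous_subspaceT => t; exact: exprn_continuous.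
pose f : CF M := exist _ _ xc.
have fE (mu : PMprod M eta) : ((pm_eval (mu i : PM M) f)%:E =
    \int[measure_of (mu i)]_(t in `[0%R, M]%classic) (t ^+ n)%R%:E)%E.
  rewrite /pm_eval fineK//; apply: integrable_fin_num => //.
  apply: bounded_measurable_integrable.
  exact: within_continuous_bounded_measurable.
have -> : [set mu : PMprod M eta |
    c%:E = \int[measure_of (mu i)]_(t in `[0%R, M]%classic) (t ^+ n)%R%:E]%E =
    (fun mu : PMprod M eta => pm_eval (mu i : PM M) f : R) @^-1` [set x | x = c].
  by apply/seteqP; split=> mu /=; rewrite -fE; [case|move=> ->].
by have /continuous_closedP := pm_eval_continuous eta i f; apply; exact: closed_eq.
Qed.

Lemma summable_idx {R : realType} (eta : option nat) (a : nat -> R) (c : R) :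
  (forall i, 0 <= a i) ->
  (forall n, \sum_(1 <= i < n | in_idx eta i) a i <= c) ->
  (\esum_(i in [set: idx eta]) (a (proj1_sig i))%:E < +oo)%E.
Proof.
move=> a0 ac; apply: (@le_lt_trans _ _ c%:E); last by rewrite ltry.
have <- : \esum_(j in [set j | in_idx eta j]) (a j)%:E =
    \esum_(i in [set: idx eta]) (a (proj1_sig i))%:E.
  apply: (reindex_esum setT _ (fun i : idx eta => proj1_sig i) (fun j => (a j)%:E)).
  split=> //.
  - by move=> i _; exact: (proj2_sig i).
  - by move=> i j _ _; exact: val_inj.
  - by move=> j jI; exists (exist _ j jI).
rewrite -nneseries_esum => [|n _]; last by rewrite lee_fin.
apply: lime_le; first by apply: is_cvg_nneseries => n _ _; rewrite lee_fin.
apply: nearW => n; rewrite sumEFin lee_fin.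
apply: le_trans (ac n); case: n => [|n]; first by rewrite !big_geq.
(* Branches are numbered from 1: index 0 fails [in_idx], so starting the sum at 0 adds nothing. *)
by rewrite big_ltn_cond// (_ : in_idx eta 0 = false)//; case: (eta).
Qed.

Theorem theorem6p6 (R : realType) (kappa : nat) (eta : option nat) (p : nat)
    (lam_tr : nat -> R) (lam_br : nat -> nat -> R) :
  (forall n : nat, eta = Some n -> (2 <= n)%N) ->
  (1 <= p)%N ->
  (forall k : nat, (k < kappa)%N -> (0 < lam_tr k)%R) ->
  (forall i j : nat, in_idx eta i -> (1 <= j <= p)%N -> (0 < lam_br i j)%R) ->
  has_subnormal_completion eta kappa p lam_tr lam_br ->
  forall M : R, (0 < M)%R ->
    compact (U_set M eta kappa p lam_tr lam_br).
Proof.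
move=> _ p1 _ _ [lam [_ _ lamE [c [sumc _]] _]] M M0.
have PMc : compact [set: PMprod M eta].
  have := @tychonoff (idx eta) (fun _ => PMw M) (fun _ => setT)
    (fun _ => PMw_compact (ltW M0)).
  by rewrite [X in compact X -> _](_ : _ = setT)//; apply/seteqP; split.
apply: subclosed_compact PMc _ => //.
pose w (i : idx eta) := lam_br (proj1_sig i) 1 ^+ 2.
have w0 i : 0 <= w i by exact: sqr_ge0.
(* Boundedness of the completion at the vertex 0 bounds the sums of the squared weights at (i,1),
   and p >= 1 identifies these weights with the given ones. *)
have wsum : (\esum_(i in [set: idx eta]) (w i)%:E < +oo)%E.
  apply: (summable_idx eta (fun i => lam_br i 1 ^+ 2) c) => [i|n].
    exact: sqr_ge0.
  rewrite (eq_bigr (fun i => lam (Br i 1) ^+ 2))// => i iI.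
  by rewrite lamE.
pose ck k : R := (\prod_(0 <= j < k) lam_tr j ^+ 2)^-1.
have ck0 k : 0 <= ck k by rewrite invr_ge0 prodr_ge0// => j _; exact: sqr_ge0.
(* Each equality for k < kappa is paired with the inequality at kappa, under which it is closed. The
   inequality also stands alone, so that it survives for kappa = 0. *)
have -> : U_set M eta kappa p lam_tr lam_br =
    (\bigcap_(ni in [set ni : nat * idx eta | (ni.1 < p)%N])
       [set mu : PMprod M eta |
         ((\prod_(2 <= j < ni.1.+2) lam_br (proj1_sig ni.2) j ^+ 2)%R%:E =
          \int[measure_of (mu ni.2)]_(t in `[0%R, M]%classic) (t ^+ ni.1)%R%:E)%E])
    `&` ([set mu | (branch_sum w kappa mu <= (ck kappa)%:E)%E] `&`
     \bigcap_(k in [set k | (k < kappa)%N])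
       [set mu | (branch_sum w kappa mu <= (ck kappa)%:E)%E /\
                 branch_sum w k mu = (ck k)%:E]).
  apply/seteqP; split=> mu.
    move=> [mom [eqs le]]; split; first by move=> [n i] /= np; exact: mom.
    by split=> // k /= kk; split=> //; exact: eqs.
  move=> [mom [le eqs]]; split; first by move=> i n np; exact: (mom (n, i)).
  by split=> // k kk; have [] := eqs k kk.
apply: closedI; first by apply: closed_bigI => -[n i] _; exact: moment_closed.
apply: closedI; first exact: branch_sum_le_closed.
by apply: closed_bigI => k kk; exact: branch_sum_eq_closed.
Qed.
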